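(* Let $\tau\subseteq\{\sqcup,\mathbin{@},-,\underline{\phantom{a}}[\underline{\phantom{a}}]\}$ and let $S$ be a nonempty set. Let $F_\tau(S)$ be the free algebra in $\mathsf{SP}({\bf 3}_\tau)$ with free generating set $S$. Then $F_\tau(S)$ embeds into $\operatorname{Choice}(S)$ via the map sending each $s\in S$ to the choice function with domain $\{A\subseteq S\mid s\in A\}$ given by $A\mapsto s$.
   Context: For nonempty sets $X,Y$, $\mathcal{P}(X,Y)$ denotes the set of all partial functions from $X$ to $Y$. Operations: override $(f\sqcup g)(x)=f(x)$ if $x\in\mathrm{dom}(f)$, $=g(x)$ if $x\in\mathrm{dom}(g)\setminus\mathrm{dom}(f)$, undefined otherwise; update $f[g]$ is the restriction of $g\sqcup f$ to $\mathrm{dom}(f)$; restrictive multiplication $f\mathbin{@}g$ is the restriction of $f$ to $\mathrm{dom}(g)$; minus $f-g$ is the restriction of $g$ to the complement of $\mathrm{dom}(f)$. ${\bf 3}$ is the algebra $\mathcal{P}(\{x\},\{+,-\})$ with these four operations and ${\bf 3}_\tau$ its reduct to $\tau$; $\mathsf{SP}({\bf 3}_\tau)$ is the class of algebras isomorphic to subalgebras of direct powers of ${\bf 3}_\tau$. A choice function on a family of sets is a map $\gamma$ with $\gamma(A)\in A$ for each set $A$ of the family. $\operatorname{Choice}(S)$ is the set of all choice functions whose domains are nonempty subsets of the powerset $\wp(S)$; it is a $\tau$-subalgebra of $\langle\mathcal{P}(\wp(S),S),\tau\rangle$, and the embedding is as $\tau$-algebras.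
   Formalization: Choice(S) is taken to include the nowhere defined choice function; requiring nonempty domains, as worded, would make it not closed under the operations (s − s is the empty function), so the embedding would fail when − is in τ. *)

(* Defs.v *)
From mathcomp Require Import all_boot boolp classical_sets.

Set Implicit Arguments.
Unset Strict Implicit.
Unset Printing Implicit Defensive.

Local Open Scope classical_set_scope.

(** Partial functions; [f x = None] means that [f] is undefined at [x]. *)
Definition pfun (X Y : Type) : Type := X -> option Y.

Section PartialFunctions.
Variables X Y : Type.
Implicit Types (f g : pfun X Y) (D : set X).

Definition dom f : set X := [set x | f x <> None].

Definition restrict f D : pfun X Y := fun x => if x \in D then f x else None.

Definition override f g : pfun X Y :=
  fun x => if f x is Some y then Some y else g x.

Definition update f g : pfun X Y := restrict (override g f) (dom f).

Definition restrictive_mul f g : pfun X Y := restrict f (dom g).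

(** It is the second argument that gets restricted. *)
Definition minus f g : pfun X Y := restrict g (~` dom f).

End PartialFunctions.

Inductive op : Type := Override | RestrictiveMul | Minus | Update.

Definition pfun_op (X Y : Type) (o : op) : pfun X Y -> pfun X Y -> pfun X Y :=
  match o with
  | Override => @override X Y
  | RestrictiveMul => @restrictive_mul X Y
  | Minus => @minus X Y
  | Update => @update X Y
  end.

Record algebra (tau : set op) : Type := Algebra {
  carrier :> Type;
  interp : forall o : op, tau o -> carrier -> carrier -> carrier
}.

Section Algebras.
Variable tau : set op.
Implicit Types A B : algebra tau.

Definition hom A B (h : A -> B) : Prop :=
  forall (o : op) (ho : tau o) (x y : A),
    h (interp ho x y) = interp ho (h x) (h y).

Definition embedding A B (h : A -> B) : Prop := hom h /\ injective h.

Definition isomorphic A B : Prop := exists h : A -> B, hom h /\ bijective h.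

Definition closed_under_ops A (P : set A) : Prop :=
  forall (o : op) (ho : tau o) (x y : A), P x -> P y -> P (interp ho x y).

Definition subalgebra A (P : set A) (clP : closed_under_ops P) : algebra tau :=
  @Algebra tau {x : A | P x} (fun o ho x y =>
    exist P (interp ho (sval x) (sval y)) (clP o ho _ _ (svalP x) (svalP y))).

Definition power (I : Type) A : algebra tau :=
  @Algebra tau (I -> A) (fun o ho x y i => interp ho (x i) (y i)).

Definition SP A B : Prop :=
  exists (I : Type) (P : set (power I A)) (clP : closed_under_ops P),
    isomorphic B (subalgebra clP).

Definition generates (S : Type) A (iota : S -> A) : Prop :=
  forall P : set A, closed_under_ops P -> (forall s, P (iota s)) ->
    forall x, P x.

(** [F] is free in the class [K], with free generating set [S] (included in
    [F] by [iota]).  Uniqueness of the extension follows from generation. *)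
Definition free_in (K : algebra tau -> Prop) (S : Type) (F : algebra tau)
    (iota : S -> F) : Prop :=
  [/\ K F, generates iota &
      forall B : algebra tau, K B -> forall f : S -> B,
        exists2 h : F -> B, hom h & forall s, h (iota s) = f s].

Definition pfun_algebra (X Y : Type) : algebra tau :=
  @Algebra tau (pfun X Y) (fun o _ => @pfun_op X Y o).

(** [true] and [false] stand for the two values [+] and [-]. *)
Definition three : algebra tau := pfun_algebra unit bool.

End Algebras.

(** Members of the domain of a choice function are automatically nonempty.
    The nowhere defined function counts as a choice function: otherwise these
    would not be closed under [minus] and [restrictive_mul]. *)
Definition choice_function (S : Type) : set (pfun (set S) S) :=
  [set gamma | forall A s, gamma A = Some s -> A s].

Lemma choice_function_closed (tau : set op) (S : Type) :
  @closed_under_ops tau (pfun_algebra tau (set S) S) (@choice_function S).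
Proof.
have restrictP (f : pfun (set S) S) D :
    choice_function f -> choice_function (restrict f D).
  by move=> Pf A s; rewrite /restrict; case: ifP => // _; apply: Pf.
have overrideP (f g : pfun (set S) S) :
    choice_function f -> choice_function g -> choice_function (override f g).
  move=> Pf Pg A s; rewrite /override.
  by case E: (f A) => [t|]; [rewrite -E; apply: Pf | apply: Pg].
case=> ? f g Pf Pg.
- exact: overrideP.
- exact: restrictP.
- exact: restrictP.
- exact: restrictP (overrideP _ _ Pg Pf).
Qed.

Definition choice_algebra (tau : set op) (S : Type) : algebra tau :=
  subalgebra (@choice_function_closed tau S).

(** The choice function with domain [{A | s \in A}] and constant value [s]. *)
Definition const_choice (S : Type) (s : S) : pfun (set S) S :=
  restrict (fun=> Some s) [set A | A s].

Lemma const_choiceP (S : Type) (s : S) : choice_function (const_choice s).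
Proof.
move=> A t; rewrite /const_choice /restrict.
by case: ifP => // /set_mem As [<-].
Qed.

Definition choice_gen (tau : set op) (S : Type) (s : S) : choice_algebra tau S :=
  exist _ (const_choice s) (@const_choiceP S s).

(* Main.v *)
Require Import Defs.
From mathcomp Require Import all_boot boolp classical_sets.

(** Evaluating partial functions at one point and recolouring their values is a
    homomorphism into [three].  These homomorphisms separate choice functions,
    so [Choice(S)] lies in [SP(3)] and freeness yields the map [h].  Conversely,
    any homomorphism [F -> 3] factors through [h]: it is evaluation at the set
    of generators on which it is defined, recoloured by its values there.
    As homomorphisms [F -> 3] separate points, [h] is injective. *)

Definition eval_at (tau : set op) (X Y : Type) (x : X) (c : Y -> bool)
    (f : pfun_algebra tau X Y) : three tau :=
  fun=> omap c (f x).

(** Each operation acts pointwise, only testing definedness and copying values, and recolouring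
    preserves definedness. *)
Lemma eval_at_hom (tau : set op) (X Y : Type) (x : X) (c : Y -> bool) :
  hom (@eval_at tau X Y x c).
Proof.
have domE (A B : Type) (f : pfun A B) a : (a \in dom f) = isSome (f a).
  apply/idP/idP => [/set_mem|fa]; first by rewrite /dom /=; case: (f a).
  by apply/mem_set; rewrite /dom /=; case: (f a) fa.
have domCE (A B : Type) (f : pfun A B) a :
    (a \in setC (dom f)) = ~~ isSome (f a).
  by rewrite in_setC domE.
case=> ho f g; apply/funext => u;
  rewrite /eval_at /= /update /restrictive_mul /minus /restrict /override
    ?domE ?domCE;
  by case: (f x); case: (g x).
Qed.

Lemma SP_embedding (tau : set op) (I : Type) (A B : algebra tau)
    (e : B -> power I A) :
  embedding e -> SP A B.
Proof.
case=> ehom einj; pose P : set (power I A) := range e.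
have clP : closed_under_ops P.
  by move=> o ho _ _ [x _ <-] [y _ <-]; exists (interp ho x y).
exists I, P, clP.
have Pe b : P (e b) by exists b.
exists (fun b => exist P (e b) (Pe b)); split.
  by move=> o ho x y; apply: eq_exist; exact: ehom.
have preim (u : subalgebra clP) : exists b, e b = sval u.
  by case: (svalP u) => b _ eb; exists b.
exists (fun u => sval (cid (preim u))) => [b|u].
  by case: cid => b' /= /einj.
by case: cid => b /= eb; case: u eb => u Pu /= eb; apply: eq_exist.
Qed.

Lemma SP_separated (tau : set op) (A B : algebra tau) (x y : B) :
  SP A B -> (forall phi : B -> A, hom phi -> phi x = phi y) -> x = y.
Proof.
move=> [I [P [clP [e [ehom ebij]]]]] phixy; apply: (bij_inj ebij).
apply: eq_sig_hprop => [? ? ?|]; first exact: Prop_irrelevance.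
apply/funext => i.
(* The separating homomorphisms are the coordinates of [e]. *)
by apply: (phixy (fun b => sval (e b) i)) => o ho a b; rewrite ehom.
Qed.

Lemma choice_algebra_SP (tau : set op) (S : Type) :
  SP (three tau) (choice_algebra tau S).
Proof.
(* Coordinate [(A, s)] records whether [f] is defined at [A] and, if so, whether its value is [s];
   two colours thus suffice for any [S]. *)
pose e (f : choice_algebra tau S) : power (set S * S) (three tau) :=
  fun i => eval_at tau _ _ i.1 (fun s => `[< s = i.2 >]) (sval f).
apply: (@SP_embedding tau _ _ _ e); split.
  by move=> o ho f g; apply/funext => i; exact: eval_at_hom.
move=> [f Pf] [g Pg] efg; apply: eq_exist; apply/funext => A.
have fgA s : omap (fun t => `[< t = s >]) (f A) =
             omap (fun t => `[< t = s >]) (g A).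
  by have := congr1 (fun u => u (A, s) tt) efg.
case: (f A) fgA => [s /(_ s)|]; case: (g A) => [t|] //=.
  by rewrite asboolT // => -[/esym/asboolP ->].
by move=> /(_ t).
Qed.

Theorem theorem3p4 (tau : set op) (S : Type) (S_nonempty : inhabited S)
    (F : algebra tau) (iota : S -> F)
    (F_free : free_in (SP (three tau)) iota) :
  exists h : F -> choice_algebra tau S,
    embedding h /\ forall s : S, h (iota s) = choice_gen tau s.
Proof.
case: F_free => F_SP F_gen F_ext.
have [h hhom hgen] := F_ext _ (choice_algebra_SP tau S) (@choice_gen tau S).
exists h; split=> //; split=> // a b hab.
apply: SP_separated F_SP _ => phi phihom.
pose A : set S := [set s | isSome (phi (iota s) tt)]%classic.
(* The default is harmless: a choice function defined at [A] takes its value in [A], where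
   [phi (iota s)] is defined. *)
pose c s := odflt true (phi (iota s) tt).
suff phiE x : phi x = eval_at tau _ _ A c (sval (h x)) by rewrite !phiE hab.
(* Both sides are homomorphisms in [x], so agreement on generators is enough. *)
apply: (F_gen (fun x => phi x = eval_at tau _ _ A c (sval (h x)))).
  by move=> o ho y z phiy phiz; rewrite phihom phiy phiz hhom /= eval_at_hom.
move=> s; apply/funext => -[].
rewrite hgen /eval_at /= /const_choice /restrict.
have -> : (A \in [set B : set S | B s]%classic) = isSome (phi (iota s) tt).
  by apply/idP/idP => [/set_mem|/mem_set].
by case E: (phi (iota s) tt) => [y|] /=; rewrite /c ?E.
Qed.
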